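(* Let $n \geq 1$ and let $G$ be a simple graph on the vertex set $[n]=\{1,\ldots,n\}$. Let $\mathcal{S}_{n,G}$ be the arrangement of affine hyperplanes in $\mathbb{R}^n$ consisting of the hyperplanes $x_i - x_j = 0$ for all $1 \leq i < j \leq n$, together with the hyperplanes $x_i - x_j = 1$ for all $1 \leq i < j \leq n$ such that $\{i,j\}$ is an edge of $G$. Let $\mathbb{Z}_{n+1}$ be the group of integers modulo $n+1$ and let $H$ be the cyclic subgroup of $\mathbb{Z}_{n+1}^n$ generated by $(1,1,\ldots,1)$. Then the regions of $\mathcal{S}_{n,G}$ are in bijection with the cosets $(a_1,\ldots,a_n)+H \in \mathbb{Z}_{n+1}^n/H$ satisfying the following condition: for every $i \in [n]$, if there exists $j$ with $i<j$ and $a_i=a_j$, and $j$ is the smallest such integer, then $\{i,j\}$ is an edge of $G$.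
   Context: A region of a finite arrangement of affine hyperplanes in $\mathbb{R}^n$ is a connected component of the complement in $\mathbb{R}^n$ of the union of the hyperplanes. The condition on cosets is well defined since adding $(1,\ldots,1)$ preserves which coordinates are equal. *)

(* Defs.v *)
From mathcomp Require Import all_boot all_order all_algebra.
From mathcomp Require Import all_classical all_reals all_analysis.
Set Implicit Arguments. Unset Strict Implicit. Unset Printing Implicit Defensive.
Import Order.TTheory GRing.Theory Num.Theory.
Local Open Scope classical_set_scope.
Local Open Scope ring_scope.

(* Vertices [n] = {1..n} are represented by 'I_n = {0..n-1} (order preserved).
   A simple graph on 'I_n: a symmetric irreflexive relation e; {i,j} is an
   edge iff e i j. *)
Definition simple_graph (n : nat) (e : rel 'I_n) : Prop :=
  irreflexive e /\ symmetric e.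

Definition S_complement (R : realType) (n : nat) (e : rel 'I_n) :
    set 'rV[R^o]_n :=
  [set x | forall i j : 'I_n, (i < j)%N ->
      x ord0 i - x ord0 j != 0 /\ (e i j -> x ord0 i - x ord0 j != 1)].

Definition S_regions (R : realType) (n : nat) (e : rel 'I_n) :
    set (set 'rV[R^o]_n) :=
  [set C | exists2 x, @S_complement R n e x &
                      C = connected_component (@S_complement R n e) x].

Definition cycH (n : nat) : set 'rV['Z_n.+1]_n :=
  [set h | exists m : nat, h = (const_mx 1) *+ m].

Definition cosetH (n : nat) (a : 'rV['Z_n.+1]_n) : set 'rV['Z_n.+1]_n :=
  [set a + h | h in @cycH n].

Definition good_rep (n : nat) (e : rel 'I_n) (a : 'rV['Z_n.+1]_n) : Prop :=
  forall i j : 'I_n, (i < j)%N -> a ord0 i = a ord0 j ->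
    (forall k : 'I_n, (i < k)%N -> (k < j)%N -> a ord0 k != a ord0 i) ->
    e i j.

Definition good_cosets (n : nat) (e : rel 'I_n) : set (set 'rV['Z_n.+1]_n) :=
  [set K | exists2 a, K = @cosetH n a & @good_rep n e a].

(* Main.v *)
Require Import Defs.
From mathcomp Require Import all_boot all_order all_algebra.
From mathcomp Require Import all_classical all_reals all_analysis.
From mathcomp Require Import zify ring lra.
Set Implicit Arguments. Unset Strict Implicit. Unset Printing Implicit Defensive.
Import Order.TTheory GRing.Theory Num.Theory numFieldNormedType.Exports.
Local Open Scope ring_scope.

(** Put [y = - x], so that the points [y i] are read from left to right. For a
    point of the complement, call a pair [i < j] close if it is an edge and
    [y i < y j < y i + 1], and keep only the maximal close pairs (the arcs).
    Arcs do not nest, so they cut the vertices into increasing chains; label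
    each vertex by the position of the first point of its chain (this is the
    bijection of Athanasiadis and Linusson). Consecutive elements of a class
    of the labelling are exactly the arcs, hence edges, and since nonnesting
    chains are served first-in first-out, the labelling determines the order
    of the points and then all close pairs, i.e. the region. Labels are
    parking functions, and each coset of H contains exactly one of those
    (cycle lemma). Conversely a parking function with the edge condition is
    realised by placing its classes, in increasing order of their labels, as
    arithmetic progressions of step 1 whose first points are slid as far
    right as their prescribed positions allow; shrinking everything slightly
    turns the steps into arcs. *)

(** * Arcs and chain labels *)

Section Arcs.
Variables (R : realFieldType) (n : nat) (e : rel 'I_n).
Implicit Types (y : 'I_n -> R) (a : 'I_n -> nat) (i j k l : 'I_n).

Definition pos y i : nat := #|[set k | y k < y i]|.

Definition close y i j : bool :=
  [&& (i < j)%N, e i j, y i < y j & y j < y i + 1].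

Definition arc y i j : bool :=
  close y i j &&
  [forall k, forall l, [&& close y k l, y k <= y i & y j <= y l] ==>
     ((k == i) && (l == j))].

(** A relation rather than a function: since arcs increase the index, the two clauses already pin
    [a] down. *)
Definition chain_label y a : Prop :=
  (forall i, (forall k, ~~ arc y k i) -> a i = pos y i) /\
  (forall k i, arc y k i -> a k = a i).

(** The points [y] do not occur here, so once [arcP] identifies arcs with these pairs, arcs can be
    read off the labels alone. *)
Definition next_in_class a i j : Prop :=
  [/\ (i < j)%N, a i = a j &
      forall k, (i < k)%N -> (k < j)%N -> a k <> a i].

Lemma ltn_pos y i j : (pos y i < pos y j)%N = (y i < y j).
Proof.
have mono : forall i j, y i <= y j -> (pos y i <= pos y j)%N.
  move=> i' j' le_ij; apply: subset_leq_card; apply/fintype.subsetP => k.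
  by rewrite !inE => /lt_le_trans; apply.
apply/idP/idP => [|lt_ij]; first by apply: contraTT; rewrite -leNgt -leqNgt; exact: mono.
apply: proper_card; apply/properP; split.
  by apply/fintype.subsetP => k; rewrite !inE => /lt_trans; apply.
by exists i; rewrite inE ?ltxx.
Qed.

Lemma leq_pos y i j : (pos y i <= pos y j)%N = (y i <= y j).
Proof. by rewrite leqNgt ltn_pos -leNgt. Qed.

Lemma pos_inj y : injective y -> injective (pos y).
Proof.
by move=> y_inj i j eq_ij; apply: y_inj; apply/le_anti; rewrite -!leq_pos eq_ij leqnn.
Qed.

Lemma pos_lt y i : (pos y i < n)%N.
Proof.
rewrite -[X in (_ < X)%N]card_ord -[X in (_ < X)%N]cardsT; apply: proper_card.
by apply/properP; split; [exact: finset.subsetT | exists i; rewrite !inE ?ltxx].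
Qed.

Lemma pos_surj y p : injective y -> (p < n)%N -> exists i, pos y i = p.
Proof.
move=> y_inj lt_pn.
have f_inj : injective (fun i => Ordinal (pos_lt y i)).
  by move=> i j [] /pos_inj; apply.
have [g _ gK] := injF_bij f_inj.
by exists (g (Ordinal lt_pn)); have /(congr1 val) := gK (Ordinal lt_pn).
Qed.

Lemma arc_close y i j : arc y i j -> close y i j.
Proof. by case/andP. Qed.

Lemma arc_max y i j k l : arc y i j -> close y k l -> y k <= y i -> y j <= y l ->
  k = i /\ l = j.
Proof.
case/andP=> _ /forallP/(_ k)/forallP/(_ l)/implyP max_ij ckl le1 le2.
by have /andP[/eqP-> /eqP->] := max_ij (introT and3P (And3 ckl le1 le2)).
Qed.

Lemma arc_ltn y i j : arc y i j -> (i < j)%N.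
Proof. by move/arc_close/and4P=> []. Qed.

Lemma arc_lt y i j : arc y i j -> y i < y j.
Proof. by move/arc_close/and4P=> []. Qed.

Lemma arc_succ_inj y i j k : arc y i j -> arc y i k -> j = k.
Proof.
move=> aij aik; have [le_jk|/ltW le_kj] := leP (y j) (y k).
  by have [] := arc_max aij (arc_close aik) (lexx _) le_jk.
by have [] := arc_max aik (arc_close aij) (lexx _) le_kj.
Qed.

(** Otherwise the interval of [(i, j)] would contain that of [(k, l)], against the maximality of the
    latter. This is the first-in first-out rule. *)
Lemma arc_nonnesting y i j k l : arc y i j -> arc y k l -> y i < y k -> y j < y l.
Proof.
move=> aij akl lt_ik; rewrite ltNge; apply/negP => le_lj.
have [eq_ik _] := arc_max akl (arc_close aij) (ltW lt_ik) le_lj.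
by rewrite eq_ik ltxx in lt_ik.
Qed.


(** Among the close pairs whose interval contains the given one, a longest is maximal for
    inclusion. *)
Lemma arc_cover y i j : injective y -> close y i j ->
  exists k l, [/\ arc y k l, y k <= y i & y j <= y l].
Proof.
move=> y_inj cij.
pose P (q : 'I_n * 'I_n) := [&& close y q.1 q.2, y q.1 <= y i & y j <= y q.2].
have P0 : P (i, j) by rewrite /P cij !lexx.
case: (Order.TotalTheory.arg_maxP (fun q : 'I_n * 'I_n => y q.2 - y q.1) P0).
move=> [k l] /and3P[/= ckl le_ki le_jl] max_kl.
exists k, l; split=> //; rewrite /arc ckl; apply/forallP => k'; apply/forallP => l'.
apply/implyP => /and3P[c' le_kk le_ll].
have := max_kl (k', l'); rewrite /P /= c' (le_trans le_kk) // (le_trans le_jl) //.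
move=> /(_ isT) le_w.
by apply/andP; split; apply/eqP; apply: y_inj; lra.
Qed.

Lemma iter_deflating (p : 'I_n -> 'I_n) i : (forall k, (p k <= k)%N) ->
  p (iter n p i) = iter n p i.
Proof.
move=> p_le.
(* Every step that moves lowers the index by at least one, which cannot happen [n] times below
   [n]. *)
have stable m : p (iter m p i) = iter m p i \/ (iter m p i + m <= i)%N.
  elim: m => [|m [IH|IH]]; [by right; rewrite addn0 | by left; rewrite iterS !IH |].
  have [/val_inj eq_p|ne_p] := eqVneq (p (iter m p i) : nat) (iter m p i : nat).
    by left; rewrite iterS !eq_p.
  by right; rewrite iterS; have := p_le (iter m p i); lia.
by case: (stable n) => // le_i; have := ltn_ord i; lia.
Qed.

Lemma chain_label_exists y : exists a, chain_label y a.
Proof.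
(* One step back along the arc ending at [i]; first points of chains stay fixed. Hence [n] steps
   lead to the first point of the chain. *)
pose p i := odflt i [pick k | arc y k i].
have p_le i : (p i <= i)%N.
  by rewrite /p; case: pickP => //= k /arc_ltn/ltnW.
have p_root i : (forall k, ~~ arc y k i) -> p i = i.
  by move=> no_arc; rewrite /p; case: pickP => //= k; rewrite (negbTE (no_arc k)).
have p_arc k i : arc y k i -> p i = k.
  move=> aki; rewrite /p; case: pickP => [l ali|/(_ k)]; last by rewrite aki.
  have [le_kl|/ltW le_lk] := leP (y k) (y l).
    by have [] := arc_max ali (arc_close aki) le_kl (lexx _).
  by have [] := arc_max aki (arc_close ali) le_lk (lexx _).
exists (fun i => pos y (iter n p i)); split=> [i no_arc|k i aki].
  by rewrite iter_fix // p_root.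
by rewrite -[k in LHS](p_arc _ _ aki) -iterSr iterS iter_deflating.
Qed.

Section Labelled.
Variables (y : 'I_n -> R) (a : 'I_n -> nat).
Hypotheses (y_inj : injective y) (ya : chain_label y a).

Lemma label_root i : exists2 r : 'I_n, (r <= i)%N & a i = pos y r.
Proof.
have [root_i step_i] := ya.
elim/ltn_ind: (nat_of_ord i) {-2}i (erefl (nat_of_ord i)) => m IH j Ej.
have [/existsP[k akj]|] := boolP [exists k, arc y k j]; last first.
  by rewrite negb_exists => /forallP/root_i ->; exists j.
have lt_kj := arc_ltn akj.
have [|r le_rk eq_r] := IH k _ k erefl; first by rewrite -Ej.
by exists r; [apply: leq_trans (ltnW lt_kj) | rewrite -(step_i _ _ akj)].
Qed.

Lemma label_le_pos i : (a i <= pos y i)%N.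
Proof.
have [root_i step_i] := ya.
elim/ltn_ind: (nat_of_ord i) {-2}i (erefl (nat_of_ord i)) => m IH j Ej.
have [/existsP[k akj]|] := boolP [exists k, arc y k j]; last first.
  by rewrite negb_exists => /forallP/root_i ->.
rewrite -(step_i _ _ akj) (leq_trans (IH k _ k erefl)) //.
  by rewrite -Ej (arc_ltn akj).
by rewrite leq_pos ltW ?(arc_lt akj).
Qed.

Lemma label_lt i : (a i < n)%N.
Proof. exact: leq_ltn_trans (label_le_pos i) (pos_lt y i). Qed.

(** Equal labels mean equal chains. Induction on the larger vertex [j]: it is not a root, since the
    root of [i] would then be [j], although a root is at most [i]. So [j] has a predecessor [l] of
    the same label, and [l] is compared with [i]; when [l < i], the induction hypothesis for [l] and
    [i] contradicts uniqueness of the successor of [l]. *)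
Lemma label_succ i j : (i < j)%N -> a i = a j ->
  exists2 k, arc y i k & (k <= j)%N.
Proof.
have [root_i step_i] := ya.
elim/ltn_ind: (nat_of_ord j) {-2}j (erefl (nat_of_ord j)) i => m IH {}j Ej i lt_ij eq_a.
have [/existsP[l alj]|] := boolP [exists k, arc y k j]; last first.
  rewrite negb_exists => /forallP/root_i root_j.
  have [r le_ri eq_r] := label_root i.
  have /pos_inj rj : pos y r = pos y j by rewrite -eq_r eq_a.
  by move: le_ri; rewrite rj // leqNgt lt_ij.
have lt_lj := arc_ltn alj; have eq_l := step_i _ _ alj.
case: (ltngtP l i) => [lt_li|lt_il|/val_inj eq_li].
- have [||k alk le_ki] := IH i _ i erefl l lt_li; [by rewrite -Ej | by rewrite eq_l |].
  by move: le_ki; rewrite (arc_succ_inj alk alj) leqNgt lt_ij.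
- have [||k aik le_kl] := IH l _ l erefl i lt_il; [by rewrite -Ej | by rewrite eq_l |].
  by exists k => //; lia.
- by exists j; rewrite -?eq_li.
Qed.

Lemma arcP i j : arc y i j <-> next_in_class a i j.
Proof.
have [root_i step_i] := ya; split=> [aij|[lt_ij eq_a between]].
  split=> [||k lt_ik lt_kj eq_k]; [exact: arc_ltn aij | exact: step_i |].
  have [k' aik' le_k'k] := label_succ lt_ik (esym eq_k).
  by move: le_k'k; rewrite (arc_succ_inj aik' aij) leqNgt lt_kj.
have [k aik le_kj] := label_succ lt_ij eq_a.
move: le_kj; rewrite leq_eqVlt => /orP[/eqP/val_inj <- //|lt_kj].
by have := between k (arc_ltn aik) lt_kj; rewrite (step_i _ _ aik).
Qed.

Lemma label_good i j : next_in_class a i j -> e i j.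
Proof. by move/arcP/arc_close/and4P=> []. Qed.

End Labelled.

(** The order is rebuilt from left to right. Both configurations have the same arcs by [arcP]. A
    root sits at its label; otherwise the point at position [p] is the successor of an earlier
    point, and nonnesting decides of which one. *)
Lemma label_pos_step y y' a p : injective y -> injective y' ->
  chain_label y a -> chain_label y' a ->
  (forall q i, (q < p)%N -> (pos y i == q) = (pos y' i == q)) ->
  forall i, pos y i = p -> pos y' i = p.
Proof.
move=> y_inj y'_inj ya ya' IH i pos_i.
have same_arc k l : arc y k l <-> arc y' k l by rewrite (arcP y_inj ya) (arcP y'_inj ya').
have ge_p k : (p <= pos y k)%N -> (p <= pos y' k)%N.
  rewrite leqNgt => not_lt; rewrite leqNgt; apply: contra not_lt => lt_p.
  by have := IH _ k lt_p; rewrite eqxx => /eqP ->.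
have ge_p' k : (p <= pos y' k)%N -> (p <= pos y k)%N.
  rewrite leqNgt => not_lt; rewrite leqNgt; apply: contra not_lt => lt_p.
  by have := IH _ k lt_p; rewrite eqxx => /esym/eqP ->.
have eq_p k : (pos y k < p)%N -> pos y' k = pos y k.
  by move=> lt_p; apply/eqP; rewrite -(IH _ _ lt_p).
have eq_p' k : (pos y' k < p)%N -> pos y k = pos y' k.
  by move=> lt_p; apply/eqP; rewrite (IH _ _ lt_p).
have [[root_y _] [root_y' _]] := (ya, ya').
have [/existsP[k aki]|] := boolP [exists k, arc y k i]; last first.
  rewrite negb_exists => /forallP no_arc.
  have no_arc' k : ~~ arc y' k i.
    by apply/negP => aki; case/negP: (no_arc k); exact: (same_arc k i).2 aki.
  by rewrite -(root_y' _ no_arc') (root_y _ no_arc).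
have [j pos_j] : exists j, pos y' j = p.
  by apply: pos_surj => //; rewrite -pos_i pos_lt.
have [/existsP[l alj]|] := boolP [exists l, arc y' l j]; last first.
  rewrite negb_exists => /forallP no_arc.
  have no_arc' l : ~~ arc y l j.
    by apply/negP => alj; case/negP: (no_arc l); exact: (same_arc l j).1 alj.
  suff /(pos_inj y_inj) -> : pos y i = pos y j by [].
  by rewrite -(root_y _ no_arc') (root_y' _ no_arc) pos_j.
have aki' := (same_arc k i).1 aki; have alj' := (same_arc l j).2 alj.
have pos_k : (pos y k < p)%N by rewrite -pos_i ltn_pos (arc_lt aki).
have pos_l : (pos y' l < p)%N by rewrite -pos_j ltn_pos (arc_lt alj).
(* The predecessors [k] and [l] lie in the part where both orders agree. If they differ, nonnesting
   pushes [i] (in [y']) or [j] (in [y]) below position [p], where the orders agree. *)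
case: (ltngtP (pos y k) (pos y l)) => [lt_kl|lt_lk|/pos_inj eq_kl].
- move: (lt_kl); rewrite (eq_p' l) // -(eq_p k) // ltn_pos.
  move/(arc_nonnesting aki' alj); rewrite -ltn_pos pos_j => lt_ij.
  by have := ge_p i; rewrite pos_i leqnn leqNgt lt_ij => /(_ isT).
- move: (lt_lk); rewrite ltn_pos.
  move/(arc_nonnesting alj' aki); rewrite -ltn_pos pos_i => lt_ji.
  by have := ge_p' j; rewrite pos_j leqnn leqNgt lt_ji => /(_ isT).
- move: alj'; rewrite -eq_kl // => akj.
  by rewrite (arc_succ_inj aki akj).
Qed.

Lemma label_pos y y' a : injective y -> injective y' ->
  chain_label y a -> chain_label y' a -> pos y =1 pos y'.
Proof.
move=> y_inj y'_inj ya ya' i.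
have same p : forall j, (pos y j == p) = (pos y' j == p).
  elim/ltn_ind: p => p IH j; apply/eqP/eqP.
    by apply: (label_pos_step y_inj y'_inj ya ya') => q k /IH.
  by apply: (label_pos_step y'_inj y_inj ya' ya) => q k /IH ->.
by apply/eqP; rewrite eq_sym -same.
Qed.

(** The right-hand side mentions [y] only through positions. It works because every close pair lies
    under an arc, and an arc is shorter than one unit. *)
Lemma closeP y a i j : injective y -> chain_label y a -> close y i j <->
  [/\ (i < j)%N, e i j, (pos y i < pos y j)%N & exists k l,
     [/\ next_in_class a k l, (pos y k <= pos y i)%N & (pos y j <= pos y l)%N]].
Proof.
move=> y_inj ya; split=> [cij|[lt_ij e_ij pos_ij [k [l [akl pos_ki pos_jl]]]]].
  have [k [l [akl le_ki le_jl]]] := arc_cover y_inj cij.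
  case/and4P: cij => -> -> lt_y _; split; rewrite ?ltn_pos //.
  by exists k, l; rewrite !leq_pos; split=> //; apply/(arcP y_inj ya).
rewrite /close lt_ij e_ij -ltn_pos pos_ij /=.
move/(arcP y_inj ya): akl => /arc_close/and4P[_ _ _ lt_l].
by move: pos_ki pos_jl; rewrite !leq_pos => ? ?; lra.
Qed.

Lemma label_close y y' a : injective y -> injective y' ->
  chain_label y a -> chain_label y' a -> close y =2 close y'.
Proof.
move=> y_inj y'_inj ya ya' i j.
have eq_pos := label_pos y_inj y'_inj ya ya'.
apply/idP/idP => [/(closeP _ _ y_inj ya)|/(closeP _ _ y'_inj ya')].
  rewrite !eq_pos => -[lt_ij e_ij pos_ij [k [l [akl ki jl]]]].
  apply/(closeP _ _ y'_inj ya'); split=> //; exists k, l.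
  by rewrite -(eq_pos k) -(eq_pos l).
rewrite -!eq_pos => -[lt_ij e_ij pos_ij [k [l [akl ki jl]]]].
by apply/(closeP _ _ y_inj ya); split=> //; exists k, l; rewrite (eq_pos k) (eq_pos l).
Qed.

End Arcs.

(** * Realising a parking function *)

Lemma exists_between_notin (R : realFieldType) (s : seq R) (lo hi : R) :
  lo < hi -> exists t, [/\ lo < t, t < hi & t \notin s].
Proof.
elim: s hi => [|x s IH] hi lt_lh; first by exists ((lo + hi) / 2); split=> //; lra.
have [[lo_x x_hi]|out] : (lo < x /\ x < hi) \/ (x <= lo \/ hi <= x).
  by case: (ltP lo x) (ltP x hi) => [] ? [] ?; auto.
  have [t [lo_t t_x ts]] := IH x lo_x; exists t; split=> //; first lra.
  by rewrite inE negb_or ts andbT; lra.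
have [t [lo_t t_hi ts]] := IH hi lt_lh; exists t; split=> //.
by rewrite inE negb_or ts andbT; apply/eqP => tx; case: out; lra.
Qed.

Lemma exists_left_of (R : realFieldType) (s F : seq R) (v : R) :
  exists t, [/\ t < v, t \notin F & forall x, x \in s -> x < v -> x < t].
Proof.
have [lo lt_lo le_lo] : exists2 lo, lo < v & forall x, x \in s -> x < v -> x <= lo.
  elim: s => [|x s [lo lt_lo IH]]; first by exists (v - 1) => //; lra.
  have [lt_xv|ge_xv] := ltP x v; last first.
    exists lo => // z; rewrite inE => /orP[/eqP-> ? |]; [lra | exact: IH].
  exists (Num.max lo x); first by rewrite gt_max lt_lo.
  move=> z; rewrite inE le_max => /orP[/eqP-> _|zs /(IH _ zs) -> //].
  by rewrite lexx orbT.
have [t [lo_t t_v tF]] := exists_between_notin F lt_lo.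
by exists t; split=> // x xs /(le_lo _ xs) ?; lra.
Qed.

Section Construction.
Variables (R : realFieldType) (n : nat) (a : 'I_n -> nat).
Implicit Types (y : 'I_n -> R) (i j k l : 'I_n).

(** Parking functions with labels counted from 0. *)
Definition parking : Prop :=
  forall p, (p <= n)%N -> (p <= #|[set i | (a i < p)%N]|)%N.

Definition rk i : nat := #|[set k : 'I_n | (k < i)%N && (a k == a i)]|.

Lemma rk_lt i : (rk i < n)%N.
Proof.
rewrite -[X in (_ < X)%N]card_ord -[X in (_ < X)%N]cardsT; apply: proper_card.
by apply/properP; split; [exact: finset.subsetT | exists i; rewrite !inE ?ltnn].
Qed.

Lemma ltn_rk i j : a i = a j -> (i < j)%N -> (rk i < rk j)%N.
Proof.
move=> eq_a lt_ij; apply: proper_card; apply/properP; split.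
  by apply/fintype.subsetP => k; rewrite !inE eq_a => /andP[/ltn_trans-> ].
by exists i; rewrite !inE ?ltnn // lt_ij eq_a eqxx.
Qed.

Lemma rk_inj i j : a i = a j -> rk i = rk j -> i = j.
Proof.
move=> eq_a eq_rk; apply: val_inj => /=.
have := ltn_rk eq_a; have := ltn_rk (esym eq_a); rewrite eq_rk ltnn.
by case: (ltngtP i j) => // _; [move=> _ /(_ isT) | move=> /(_ isT)].
Qed.

Lemma rk_next i j : next_in_class a i j -> rk j = (rk i).+1.
Proof.
case=> lt_ij eq_a between.
have -> : (rk i).+1 = #|i |: [set k : 'I_n | (k < i)%N && (a k == a i)]|.
  by rewrite cardsU1 !inE ltnn.
apply: eq_card => k; rewrite !inE eq_a; have [->|ne_ki] := eqVneq k i.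
  by rewrite lt_ij eq_a eqxx.
case: (ltngtP k i) => [lt_ki|lt_ik|/val_inj eq_ki]; last by rewrite eq_ki eqxx in ne_ki.
  by rewrite (ltn_trans lt_ki lt_ij).
by apply/negP => /andP[lt_kj /eqP]; rewrite -eq_a; exact: between.
Qed.

Lemma rk_pred j : (0 < rk j)%N -> exists i, next_in_class a i j.
Proof.
rewrite card_gt0 => /finset.set0Pn[i0]; rewrite inE => Pi0.
case: (@arg_maxnP _ i0 (fun k : 'I_n => (k < j)%N && (a k == a j)) val Pi0).
move=> i /andP[lt_ij /eqP eq_a] max_i.
exists i; split=> // k lt_ik lt_kj eq_k.
by have := max_i k; rewrite lt_kj eq_k eq_a eqxx => /(_ isT) /=; rewrite leqNgt lt_ik.
Qed.

Lemma next_rk i j : a i = a j -> rk j = (rk i).+1 -> next_in_class a i j.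
Proof.
move=> eq_a rk_j; have [|u uj] := @rk_pred j; first by rewrite rk_j.
have -> // : i = u; case: (uj) => _ eq_u _; apply: rk_inj; first by rewrite eq_u.
by apply: succn_inj; rewrite -rk_j (rk_next uj).
Qed.

(* Only the points [y i] with [a i < m] have been placed: each class starts
   at the prescribed position, and whenever a point lies less than one unit
   to the left of a class start, the two are covered by a step of some class. *)
Definition placed m y : Prop :=
  [/\ forall i j, (a i < m)%N -> a i = a j -> y i + (rk j)%:R = y j + (rk i)%:R,
      forall i, (a i < m)%N -> rk i = 0%N ->
        #|[set k | (a k < m)%N && (y k < y i)]| = a i,
      forall i j, (a i < m)%N -> (a j < m)%N -> a i <> a j ->
        y i <> y j /\ y i <> y j + 1 &
      forall i j, (a i < m)%N -> (a j < m)%N -> rk j = 0%N -> y i < y j ->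
        y j < y i + 1 ->
        exists k, [/\ (a k < m)%N, (0 < rk k)%N, y j < y k & y k <= y i + 1]].

Lemma placed_inj m y i j : placed m y -> (a i < m)%N -> (a j < m)%N ->
  y i = y j -> i = j.
Proof.
move=> [step _ diff _] im jm eq_y; have [eq_a|/eqP ne_a] := eqVneq (a i) (a j).
  apply: rk_inj (eq_a) _; apply/eqP; rewrite -(eqr_nat R); apply/eqP.
  by have := step i j im eq_a; lra.
by have [] := diff i j im jm ne_a.
Qed.

(** The parking condition supplies at least [m] placed points. If there are more, [v] is the one of
    rank [m], counted from 0; if there are exactly [m], [v] lies far to the right. *)
Lemma exists_cut m y : placed m y -> (m <= #|[set i | (a i < m)%N]|)%N ->
  exists v, #|[set k | (a k < m)%N && (y k < v)]| = m /\
    ((exists2 k, (a k < m)%N & v = y k) \/ (forall k, (a k < m)%N -> y k + 1 < v)).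
Proof.
move=> Py; rewrite leq_eqVlt => /orP[/eqP card_m|lt_m].
  exists (\sum_i `|y i| + 2).
  have lt_v k : y k + 1 < \sum_i `|y i| + 2.
    have : y k <= \sum_i `|y i|; last lra.
    rewrite (bigD1 k) //=; have := ler_norm (y k).
    have : 0 <= \sum_(i | i != k) `|y i| by apply: sumr_ge0.
    lra.
  split; last by right.
  rewrite [RHS]card_m; apply: eq_card => k; rewrite !inE; case: (a k < m)%N => //=.
  by have := lt_v k => ?; apply/idP; lra.
pose s := [seq y k | k in [set i | (a i < m)%N]].
have s_uniq : uniq s.
  rewrite map_inj_in_uniq ?enum_uniq // => i j; rewrite !mem_enum !inE => im jm.
  exact: placed_inj Py im jm.
have size_s : size s = #|[set i | (a i < m)%N]| by rewrite size_image.
have lt_ms : (m < size (sort <=%O s))%N by rewrite size_sort size_s.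
exists (nth 0 (sort <=%O s) m); split; last first.
  left; have := mem_nth 0 lt_ms; rewrite mem_sort => /fintype.imageP[k].
  by rewrite inE => km ->; exists k.
have s_sorted : sorted <%O (sort <=%O s) by rewrite sort_lt_sorted.
have := count_lt_nth 0 s_sorted lt_ms.
have /permP-> : perm_eq (sort <=%O s) s by rewrite perm_sort.
set v := nth _ _ _ => count_v; rewrite -[RHS]count_v.
rewrite /s count_map cardE -size_filter; congr size.
rewrite -filter_predI /enum_mem; apply: eq_filter => k /=.
by rewrite !inE andbC.
Qed.

(** Class [m] becomes [t, t + 1, ...] with [t] just left of the cut [v], so exactly [m] points
    precede its start. Earlier starts lie left of [t] and keep their counts. *)
Lemma placed_step m y : placed m y -> (m <= #|[set i | (a i < m)%N]|)%N ->
  exists y', placed m.+1 y'.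
Proof.
move=> Py card_m; have [v [count_v cut_v]] := exists_cut Py card_m.
have [step start diff cover] := Py.
(* [t] must exceed every [y k] and every [y k + 1] that is below [v]. *)
pose s := [seq y k | k : 'I_n] ++ [seq y k + 1 | k : 'I_n].
(* Forbidden values of [t]: those for which some new point [t + r] is at distance 0 or 1 from an old
   one. *)
pose F := [seq x - r%:R | x <- s ++ [seq y k - 1 | k : 'I_n], r <- iota 0 n].
have [t [t_v tF left_t]] := exists_left_of s F v.
have t_y k : y k < v -> y k < t.
  by apply: left_t; rewrite mem_cat; apply/orP; left; apply: fintype.image_f.
have t_y1 k : y k + 1 < v -> y k + 1 < t.
  apply: left_t; rewrite mem_cat; apply/orP; right.
  exact: (fintype.image_f (fun k => y k + 1)).
have tF' x i : x \in s ++ [seq y k - 1 | k : 'I_n] -> t + (rk i)%:R <> x.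
  move=> xs eq_x; case/negP: tF; rewrite (_ : t = x - (rk i)%:R); last lra.
  by apply: allpairs_f; rewrite ?mem_iota ?rk_lt.
have start_lt i : (a i < m)%N -> rk i = 0%N -> y i < t.
  move=> im rk_i; apply: t_y; rewrite ltNge; apply/negP => le_v.
  have := start i im rk_i.
  suff : (m <= #|[set k | (a k < m)%N && (y k < y i)%R]|)%N by lia.
  rewrite -[X in (X <= _)%N]count_v; apply: subset_leq_card; apply/fintype.subsetP => k.
  by rewrite !inE => /andP[-> /lt_le_trans->].
exists (fun i => if (a i == m)%N then t + (rk i)%:R else y i).
have count_t x : x <= t ->
  #|[set k | (a k < m.+1)%N && ((if a k == m then t + (rk k)%:R else y k) < x)]|
  = #|[set k | (a k < m)%N && (y k < x)]|.
  move=> le_xt; apply: eq_card => k; rewrite !inE ltnS leq_eqVlt.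
  have [->|//] := eqVneq; rewrite ltnn /=; apply/negbTE; rewrite -leNgt.
  by have : 0 <= (rk k)%:R :> R by []; lra.
have ltm i : (a i < m.+1)%N -> a i != m -> (a i < m)%N by lia.
split=> [i j im eq_a|i im rk_i|i j im jm ne_a|i j im jm rk_j].
- rewrite -eq_a; case: eqVneq => [_|ne_i]; first by ring.
  by apply: step => //; exact: ltm.
- case: eqVneq => [->|ne_i]; last first.
    have im' := ltm _ im ne_i.
    by rewrite count_t ?start //; apply/ltW/start_lt.
  rewrite rk_i addr0 count_t // -[RHS]count_v; apply: eq_card => k; rewrite !inE.
  case: (a k < m)%N => //=; apply/idP/idP; [lra | exact: t_y].
- case: (eqVneq (a i) m) => [ai|ne_i]; case: (eqVneq (a j) m) => [aj|ne_j].
  + by rewrite ai aj in ne_a.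
  + split; apply: tF'; rewrite /s !mem_cat.
      by rewrite (fintype.image_f y).
    by rewrite (fintype.image_f (fun k => y k + 1)) ?orbT.
  + split=> eq_y.
      by apply: (@tF' (y i) j) => //; rewrite /s !mem_cat (fintype.image_f y).
    apply: (@tF' (y i - 1) j); last lra.
    by rewrite mem_cat (fintype.image_f (fun k => y k - 1)) ?orbT.
  + by apply: diff => //; exact: ltm.
- have rk_ge0 : 0 <= (rk i)%:R :> R by [].
  case: (eqVneq (a j) m) => [aj|ne_j]; case: (eqVneq (a i) m) => [ai|ne_i].
  + by rewrite rk_j; lra.
  + rewrite rk_j addr0 => lt_it lt_ti1.
    (* Thus [v] is not the far-right cut but a point [y k]. It has [m] points to its left, more than
       its label, so it is no class start and ends the covering step. *)
    have le_v : v <= y i + 1 by rewrite leNgt; apply/negP => /t_y1; lra.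
    case: cut_v => [[k km v_k]|/(_ i (ltm _ im ne_i))]; last lra.
    exists k; split; [exact: ltnW | | |].
    * rewrite lt0n; apply/eqP => rk_k; have := start k km rk_k.
      by rewrite -v_k count_v; lia.
    * by case: eqVneq => [|_]; [lia | rewrite -v_k].
    * by case: eqVneq => [|_]; [lia | rewrite -v_k].
  + by have := start_lt j (ltm _ jm ne_j) rk_j; lra.
  + move=> lt_ij lt_ji1.
    have [k [km rk_k lt_jk le_k]] :=
      cover i j (ltm _ im ne_i) (ltm _ jm ne_j) rk_j lt_ij lt_ji1.
    by exists k; split=> //; [exact: ltnW | |]; case: eqVneq => //; lia.
Qed.

Lemma placed_exists : parking -> exists y, placed n y.
Proof.
move=> park; suff: forall m, (m <= n)%N -> exists y, placed m y by apply.
elim=> [_|m IH lt_mn]; first by exists (fun=> 0); split.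
have [y Py] := IH (ltnW lt_mn).
exact: placed_step Py (park _ (ltnW lt_mn)).
Qed.

Lemma parking_lt i : parking -> (a i < n)%N.
Proof.
move=> /(_ n (leqnn n)) card_n.
suff : [set i | (a i < n)%N] == finset.setT by move/eqP/setP/(_ i); rewrite !inE.
by rewrite eqEcard finset.subsetT cardsT card_ord.
Qed.

End Construction.

Lemma exists_threshold (R : realFieldType) (s : seq R) :
  exists2 t, 1 < t & forall x, x \in s -> 1 < x -> t < x.
Proof.
elim: s => [|x s [t lt_t IH]]; first by exists 2 => //; lra.
have [lt_x|le_x] := ltP 1 x; last first.
  by exists t => // z; rewrite inE => /orP[/eqP-> |]; [lra | exact: IH].
exists (Num.min t ((1 + x) / 2)); first by rewrite lt_min lt_t /=; lra.
move=> z; rewrite inE => /orP[/eqP-> _|zs /(IH _ zs) lt_z].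
  by rewrite gt_min; apply/orP; right; lra.
by rewrite gt_min lt_z.
Qed.

Lemma chain_label_surj (R : realFieldType) n (e : rel 'I_n) (a : 'I_n -> nat) :
  parking a -> (forall i j, next_in_class a i j -> e i j) ->
  exists y : 'I_n -> R, [/\ injective y, forall i j, y j <> y i + 1 & chain_label e y a].
Proof.
move=> park good; have [y Py] := placed_exists R park.
have an i : (a i < n)%N := parking_lt i park.
have [step start diff cover] := Py.
have y_inj : injective y by move=> i j; exact: placed_inj Py (an i) (an j).
(* No distance between two points lies in [(1, t]]. Dividing by [t] makes distances equal to 1
   shorter than 1 and keeps the larger ones above 1. *)
have [t t1 t_lt] := exists_threshold [seq y q.2 - y q.1 | q : 'I_n * 'I_n].
have t_gap i j : 1 < y j - y i -> t < y j - y i.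
  by apply: t_lt; apply/fintype.imageP; exists (i, j).
pose z i := y i / t.
have zE i : y i = t * z i by rewrite /z mulrC divfK //; lra.
have z_le i j : (z i <= z j) = (y i <= y j) by rewrite !zE ler_pM2l //; lra.
have z_lt i j : (z i < z j) = (y i < y j) by rewrite !zE ltr_pM2l //; lra.
have z_lt1 i j : (z j < z i + 1) = (y j <= y i + 1).
  have -> : (z j < z i + 1) = (y j < y i + t).
    rewrite !zE (_ : t * z i + t = t * (z i + 1)) ?ltr_pM2l //; [lra | ring].
  apply/idP/idP => [lt_t|]; last lra.
  by rewrite leNgt; apply/negP => lt1; have := t_gap i j; lra.
have closeE i j : close e z i j = [&& (i < j)%N, e i j, y i < y j & y j <= y i + 1].
  by rewrite /close z_lt z_lt1.
have next_y i j : next_in_class a i j -> y j = y i + 1.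
  move=> ij; case: (ij) => _ eq_a _; have := step i j (an i) eq_a.
  by rewrite (rk_next ij) -natr1; lra.
have next_close i j : next_in_class a i j -> close e z i j.
  move=> ij; rewrite closeE (good _ _ ij) (next_y _ _ ij) lexx.
  by case: ij => ->; rewrite ltrDl ltr01.
have arcE i j : arc e z i j <-> next_in_class a i j.
  split=> [aij|ij]; last first.
    rewrite /arc next_close //; apply/forallP => k; apply/forallP => l.
    apply/implyP; rewrite closeE !z_le => /and3P[/and4P[_ _ _ kl] ki jl].
    have yj := next_y _ _ ij.
    by apply/andP; split; apply/eqP; apply: y_inj; lra.
  have := arc_close aij; rewrite closeE => /and4P[lt_ij e_ij lt_y].
  rewrite le_eqVlt => /orP[/eqP y_j|lt_1].
    have [eq_a|/eqP ne_a] := eqVneq (a i) (a j).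
      apply: next_rk => //; apply/eqP; rewrite -(eqr_nat R) -natr1; apply/eqP.
      by have := step i j (an i) eq_a; lra.
    by have [_] := diff j i (an j) (an i) (not_eq_sym ne_a).
  (* A close pair at distance below 1 in [y] is covered by a step of length 1: the one given by
     [cover] if [j] starts its class, otherwise the step ending at [j]. Hence it is not maximal. *)
  have [k [k_gt0 lt_jk le_k]] :
      exists k, [/\ (0 < rk a k)%N, y j <= y k & y k <= y i + 1].
    have [rk_j|rk_j] := posnP (rk a j).
      have [k [_ ? ? ?]] := cover i j (an i) (an j) rk_j lt_y lt_1.
      by exists k; split=> //; lra.
    by exists j; split=> //; lra.
  have [u uk] := rk_pred k_gt0; have y_k := next_y _ _ uk.
  have [||ui kj] := arc_max aij (next_close _ _ uk); rewrite ?z_le //; first lra.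
  by move: y_k; rewrite ui kj; lra.
exists z; split=> [i j /eqP|i j|].
- by rewrite eq_le !z_le -eq_le => /eqP/y_inj.
- move=> eq_z; have yj : y j = y i + t by rewrite !zE eq_z; ring.
  by have := t_gap i j; lra.
split=> [i no_arc|k i /arcE[]//].
rewrite -(start i) //.
  by rewrite /pos; apply: eq_card => k; rewrite !inE an z_lt.
have [//|/rk_pred[k /arcE]] := posnP (rk a i).
by rewrite (negbTE (no_arc k)).
Qed.

(** * The cycle lemma and cosets *)

Local Open Scope classical_set_scope.
Local Open Scope card_scope.

(** For [m > 0], at least [n + 1 - m] indices have [a i < n + 1 - m] and at least [m] have
    [b i < m]. These sets are disjoint, which is one index too many. *)
Lemma parking_shift_eq0 n (a b : 'I_n -> nat) m : parking a -> parking b ->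
  (m <= n)%N -> (forall i, b i = (a i + m) %% n.+1)%N -> m = 0%N.
Proof.
move=> pa pb le_mn bE; apply/eqP; rewrite -leqn0 leqNgt; apply/negP => m_gt0.
have ca := pa (n.+1 - m)%N ltac:(lia); have cb := pb m le_mn.
have := cardsUI [set i | (a i < n.+1 - m)%N]%SET [set i | (b i < m)%N]%SET.
have -> : ([set i | (a i < n.+1 - m)%N] :&: [set i | (b i < m)%N] = finset.set0)%SET.
  apply/setP => i; rewrite !inE bE; apply/negP => /andP[lt_a].
  by rewrite modn_small; lia.
set U := (_ :|: _)%SET.
have : (#|U| <= n)%N by rewrite -[X in (_ <= X)%N]card_ord max_card.
rewrite cards0; lia.
Qed.


Lemma parking_shift_exists n (b : 'I_n -> nat) : (forall i, b i <= n)%N ->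
  exists2 m, (m <= n.+1)%N & parking (fun i => (b i + m) %% n.+1)%N.
Proof.
move=> b_le.
pose N p := #|[set i | (b i < p)%N]%SET|.
(* Lexicographic key: [N p - p], raised by [n] to stay in the naturals, then [p] to break ties. *)
pose f (p : 'I_n.+1) := ((N p + (n - p)) * n.+1 + p)%N.
(* the first minimum of [N p - p] over [0 <= p <= n] *)
have [s _ s_min] := @arg_minnP _ (ord0 : 'I_n.+1) xpredT f isT.
have le_s (q : 'I_n.+1) : (N s + (n - s) <= N q + (n - q))%N /\
    (q < s -> N s + (n - s) < N q + (n - q))%N.
  have := s_min q isT; have := ltn_ord q; have := ltn_ord s; rewrite /f.
  by move: (N s + (n - s))%N (N q + (n - q))%N => u v s_lt q_lt ?; split=> *; nia.
have Ns_le : (N s <= n)%N by rewrite -[X in (_ <= X)%N]card_ord max_card.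
exists (n.+1 - s)%N; first exact: leq_subr.
move=> p le_pn.
have s_le : (s <= n)%N by rewrite -ltnS.
have shift i :
  ((b i + (n.+1 - s)) %% n.+1 = if s <= b i then b i - s else b i + n.+1 - s)%N.
  case: leqP => [le_sb|lt_bs]; last by rewrite modn_small; have := b_le i; lia.
  rewrite (_ : b i + (n.+1 - s) = b i - s + n.+1)%N; last by lia.
  by rewrite modnDr modn_small //; have := b_le i; lia.
set A := [set i | _]%SET.
have [le_n|gt_n] := leqP (s + p) n.
  have := le_s (Ordinal (le_n : (s + p < n.+1)%N)); rewrite /= => -[le_N lt_N].
  have : (N (s + p) <= N s + #|A|)%N; last by move: #|A| => c; lia.
  apply: leq_trans (leq_card_setU _ _).1; apply: subset_leq_card.
  apply/fintype.subsetP => i; rewrite !inE shift; by case: (leqP s (b i)) => /=; lia.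
(* The window of length [p] starting at [s] wraps around and ends before [s]; strict minimality
   there makes up for the modulus being [n + 1] instead of [n]. *)
have q_lt : (s + p - n.+1 < n.+1)%N by lia.
have := le_s (Ordinal q_lt); rewrite /= => -[le_N lt_N].
have := cardsUI A [set i | (b i < s)%N]%SET.
have -> : (A :|: [set i | (b i < s)%N] = finset.setT)%SET.
  apply/setP => i; rewrite !inE shift.
  case: (leqP s (b i)) => /= [|_]; last by rewrite orbT.
  by rewrite orbF => ?; have := b_le i; lia.
rewrite cardsT card_ord.
have : (N (s + p - n.+1) <= #|A :&: [set i | b i < s]%SET|)%N.
  apply: subset_leq_card; apply/fintype.subsetP => i; rewrite !inE shift.
  by case: (leqP s (b i)) => /=; lia.
by rewrite -/(N s); move: #|A| #|_ :&: _| => c d; lia.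
Qed.

Definition row_of_nat n (a : 'I_n -> nat) : 'rV['Z_n.+1]_n := \row_i (a i)%:R.

(** Positivity of [n] matters: ['Z_1] has two elements, so ['Z_n.+1] has the intended order only
    from [n = 1] on. *)
Lemma natr_Zp_inj n p q : (0 < n)%N -> (p <= n)%N -> (q <= n)%N ->
  p%:R = q%:R :> 'Z_n.+1 -> p = q.
Proof.
move=> n_gt0 le_p le_q /(congr1 (fun x : 'Z_n.+1 => x : nat)).
by rewrite !val_Zp_nat // !modn_small.
Qed.

Lemma cosetHP n (a b : 'rV['Z_n.+1]_n) : (0 < n)%N ->
  cosetH a = cosetH b <-> exists m, b = a + (const_mx 1) *+ m.
Proof.
move=> n_gt0; split=> [eq_ab|[m ->]].
  have : cosetH a b by rewrite eq_ab; exists 0; [exists 0%N | rewrite addr0].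
  by case=> _ [m ->] <-; exists m.
have order_H : (const_mx 1 : 'rV['Z_n.+1]_n) *+ n.+1 = 0.
  by apply/rowP => i; rewrite mulmxnE !mxE pchar_Zp.
apply/seteqP; split=> _ [_ [k ->] <-].
  (* [m * n] plays the role of [- m], because [m + m * n] is a multiple of [n + 1]. *)
  exists (const_mx 1 *+ (k + m * n)); first by exists (k + m * n)%N.
  rewrite -addrA -mulrnDr (_ : m + (k + m * n) = k + n.+1 * m)%N; last by lia.
  by rewrite mulrnDr mulrnA order_H mul0rn addr0.
exists (const_mx 1 *+ (m + k)); first by exists (m + k)%N.
by rewrite mulrnDr addrA.
Qed.

Lemma parking_coset_inj n (a b : 'I_n -> nat) : (0 < n)%N ->
  parking a -> parking b ->
  cosetH (row_of_nat a) = cosetH (row_of_nat b) -> a = b.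
Proof.
move=> n_gt0 pa pb /(cosetHP _ _ n_gt0)[m /rowP eq_ab].
have bE i : (b i = (a i + m %% n.+1) %% n.+1)%N.
  have := eq_ab i; rewrite mxE mxE mulmxnE !mxE -natrD.
  move=> /(congr1 (fun x : 'Z_n.+1 => x : nat)); rewrite !val_Zp_nat //.
  by rewrite modn_small ?modnDmr // ltnS ltnW ?parking_lt.
have m0 : (m %% n.+1 = 0)%N.
  by apply: (parking_shift_eq0 pa pb _ bE); rewrite -ltnS ltn_mod.
apply/funext => i; rewrite bE m0 addn0 modn_small //.
by rewrite ltnS ltnW ?parking_lt.
Qed.

Lemma good_rep_shift n (e : rel 'I_n) (a : 'rV['Z_n.+1]_n) m :
  good_rep e a -> good_rep e (a + (const_mx 1) *+ m).
Proof.
move=> good i j lt_ij; rewrite !mxE !mulmxnE !mxE => /addIr eq_a between.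
apply: good => // k lt_ik lt_kj; have := between k lt_ik lt_kj.
by rewrite !mxE mulmxnE !mxE; apply: contra => /eqP->.
Qed.

Lemma good_row_of_nat n (e : rel 'I_n) (a : 'I_n -> nat) : (0 < n)%N ->
  (forall i, a i <= n)%N ->
  good_rep e (row_of_nat a) <-> (forall i j, next_in_class a i j -> e i j).
Proof.
move=> n_gt0 a_le; have inj i j := natr_Zp_inj n_gt0 (a_le i) (a_le j).
split=> [good i j [lt_ij eq_a between]|good i j lt_ij].
  apply: good => // [|k lt_ik lt_kj]; rewrite !mxE ?eq_a //.
  by apply/eqP => /inj eq_k; apply: (between k) => //; rewrite eq_k eq_a.
rewrite !mxE => /inj eq_a between; apply: good; split=> // k lt_ik lt_kj eq_k.
by have := between k lt_ik lt_kj; rewrite !mxE eq_k eqxx.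
Qed.

Lemma parking_in_coset n (b : 'rV['Z_n.+1]_n) : (0 < n)%N ->
  exists (a : 'I_n -> nat) m,
    parking a /\ row_of_nat a = b + (const_mx 1) *+ m.
Proof.
move=> n_gt0.
have b_le i : (b ord0 i <= n)%N.
  by have := ltn_ord (b ord0 i); rewrite [X in (_ < X)%N]Zp_cast.
have [m _ park] := parking_shift_exists b_le.
exists (fun i => (b ord0 i + m) %% n.+1)%N, m; split=> //.
apply/rowP => i; rewrite [RHS]mxE mulmxnE !mxE Zp_nat_mod // natrD.
by rewrite natr_Zp.
Qed.

(** * Regions *)

Lemma convex_combination_lt (R : realFieldType) (t a a' b b' : R) :
  0 <= t -> t <= 1 -> a < b -> a' < b' ->
  (1 - t) * a + t * a' < (1 - t) * b + t * b'.
Proof.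
rewrite le_eqVlt => /orP[/eqP<- _ ? _|t_gt0 t_le1 lt_ab lt_ab']; first by lra.
apply: ler_ltD; last by rewrite ltr_pM2l.
by apply: ler_wpM2l; lra.
Qed.

Section Regions.
Variables (R : realType) (n : nat) (e : rel 'I_n).
Implicit Types (x : 'rV[R^o]_n) (i j k : 'I_n).
Local Notation S := (@S_complement R n e).

Definition opp_coord x : 'I_n -> R := fun i => - (x ord0 i : R).

(** [close] need not record the side of [x_i - x_j = 1] when [y j < y i], as the order already
    decides it. *)
Definition same_side x x' : Prop :=
  forall i j, (opp_coord x i < opp_coord x j) = (opp_coord x' i < opp_coord x' j) /\
              close e (opp_coord x) i j = close e (opp_coord x') i j.

Lemma S_complementP x : S x <->
  injective (opp_coord x) /\
  (forall i j, (i < j)%N -> e i j -> opp_coord x j <> opp_coord x i + 1).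
Proof.
split=> [Sx|[x_inj x_ne] i j lt_ij].
  split=> [i j eq_ij|i j lt_ij e_ij eq_ij]; last first.
    by have [_ /(_ e_ij)/eqP] := Sx i j lt_ij; apply; rewrite /opp_coord in eq_ij; lra.
  apply: val_inj; case: (ltngtP i j) => // lt_ij;
    by have [/eqP+ _] := Sx _ _ lt_ij; case; rewrite /opp_coord in eq_ij; lra.
split=> [|e_ij]; apply/eqP => eq_x.
  have /x_inj ij : opp_coord x i = opp_coord x j by rewrite /opp_coord; lra.
  by rewrite ij ltnn in lt_ij.
by apply: (x_ne i j lt_ij e_ij); rewrite /opp_coord; lra.
Qed.

Lemma opp_coord_continuous i : continuous (opp_coord ^~ i).
Proof.
move=> x; apply: continuousN; exact: coord_continuous.
Qed.

Lemma connected_no_crossing (A : set 'rV[R^o]_n) (f : 'rV[R^o]_n -> R) x x' :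
  connected A -> continuous f -> A x -> A x' -> (forall z, A z -> f z <> 0) ->
  f x < 0 -> f x' < 0.
Proof.
move=> cA cf Ax Ax' f_ne0 fx_lt0.
have : connected (f @` A).
  by apply: connected_continuous_connected => //; exact: continuous_subspaceT.
move/connected_intervalP => itvA; rewrite ltNge; apply/negP => fx'_ge0.
have [|z Az fz] := itvA _ _ (imageP f Ax) (imageP f Ax') 0; last exact: f_ne0 fz.
by rewrite (ltW fx_lt0).
Qed.

(** Intermediate values: the functions [y i - y j - c], with [c] equal to 0 or 1, do not vanish on
    the component where they define a hyperplane of the arrangement. *)
Lemma component_same_side x x' : S x -> connected_component S x x' -> same_side x x'.
Proof.
move=> Sx cx'.
pose A := connected_component S x.
have cA : connected A by exact: component_connected.
have AS : A `<=` S by exact: connected_component_sub.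
have Ax : A x by exact: connected_component_refl.
have lt_same i j c : (forall z, S z -> opp_coord z i - opp_coord z j - c <> 0) ->
    (opp_coord x i - opp_coord x j - c < 0) = (opp_coord x' i - opp_coord x' j - c < 0).
  move=> ne0.
  have cf : continuous (fun z : 'rV[R^o]_n => opp_coord z i - opp_coord z j - c : R^o).
    move=> z; apply: (@continuousB R _ _
      (fun z : 'rV[R^o]_n => opp_coord z i - opp_coord z j : R^o)
      (cst (c : R^o))); last exact: cst_continuous.
    by apply: (@continuousB R _ _ (opp_coord ^~ i : 'rV[R^o]_n -> R^o) (opp_coord ^~ j));
      exact: opp_coord_continuous.
  have neA z : A z -> opp_coord z i - opp_coord z j - c <> 0 by move=> /AS/ne0.
  apply/idP/idP.
    exact: (connected_no_crossing cA cf Ax cx' neA).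
  exact: (connected_no_crossing cA cf cx' Ax neA).
move=> i j.
have lt_ij : (opp_coord x i < opp_coord x j) = (opp_coord x' i < opp_coord x' j).
  have [->|ne_ij] := eqVneq i j; first by rewrite !ltxx.
  have := lt_same i j 0; rewrite !subr0 !subr_lt0; apply=> z /S_complementP[z_inj _].
  by move=> eq_z; case/eqP: ne_ij; apply: z_inj; lra.
split=> //; rewrite /close lt_ij; case lt_n: (i < j)%N => //=; case e_ij: (e i j) => //=.
congr (_ && _); have := lt_same j i 1.
have E z : (opp_coord z j - opp_coord z i - 1 < 0) = (opp_coord z j < opp_coord z i + 1).
  by rewrite -addrA -opprD subr_lt0.
rewrite !E; apply=> z /S_complementP[_ /(_ i j lt_n e_ij)].
by move=> + ?; apply; lra.
Qed.

(** Open half-spaces are convex, so the segment from [x] to [x'] meets no hyperplane and is a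
    connected subset of the complement. *)
Lemma same_side_component x x' : S x -> S x' -> same_side x x' ->
  connected_component S x = connected_component S x'.
Proof.
move=> Sx Sx' same; apply: same_connected_component.
pose g (t : R) : 'rV[R^o]_n := x + t *: (x' - x).
have g_cont : continuous g.
  move=> t; apply: cvgD; first exact: cvg_cst.
  by apply: cvgZr_tmp; exact: cvg_id.
have g_conn : connected (g @` `[0, 1]).
  apply: connected_continuous_connected; first exact: segment_connected.
  exact: continuous_subspaceT.
have gS : g @` `[0, 1] `<=` S.
  move=> _ [t + <-]; rewrite /= in_itv /= => /andP[t0 t1].
  have coord_g i : opp_coord (g t) i = (1 - t) * opp_coord x i + t * opp_coord x' i.
    by rewrite /opp_coord /g !mxE; ring.
  have [x_inj x_ne] := (S_complementP x).1 Sx.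
  have [x'_inj x'_ne] := (S_complementP x').1 Sx'.
  apply/S_complementP.
  have lt_g i j : opp_coord x i < opp_coord x j -> opp_coord (g t) i < opp_coord (g t) j.
    move=> lt_x; have lt_x' : opp_coord x' i < opp_coord x' j by rewrite -(same i j).1.
    by rewrite !coord_g; exact: convex_combination_lt.
  split=> [i j eq_g|i j lt_ij e_ij].
    apply: x_inj; case: (ltgtP (opp_coord x i) (opp_coord x j)) => // /lt_g;
      by rewrite eq_g ltxx.
  rewrite !coord_g => eq_g.
  have ne_ij : opp_coord x i <> opp_coord x j.
    by move/x_inj => ij; rewrite ij ltnn in lt_ij.
  have [s1 s2] := same i j; move: s2 (x_ne i j lt_ij e_ij) (x'_ne i j lt_ij e_ij).
  rewrite /close lt_ij e_ij -s1 /=.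
  case: (ltgtP (opp_coord x i) (opp_coord x j)) s1 =>
    [lt_x|gt_x|//] /esym s1 /= s2 n1 n2; last first.
    have le_x' : opp_coord x' j < opp_coord x' i + 1.
      by move: s1; rewrite ltNge => /negbFE; lra.
    have lt_x1 : opp_coord x j < opp_coord x i + 1 by lra.
    by have := convex_combination_lt t0 t1 lt_x1 le_x'; lra.
  case: (ltgtP (opp_coord x j) (opp_coord x i + 1)) s2 n1 => // cmp /esym s2 _.
    by have := convex_combination_lt t0 t1 cmp s2; lra.
  case: (ltgtP (opp_coord x' j) (opp_coord x' i + 1)) s2 n2 => // cmp' _ _.
  by have := convex_combination_lt t0 t1 cmp cmp'; lra.
apply: (connected_component_max _ gS g_conn).
  by exists 0; rewrite /g ?scale0r ?addr0 //= in_itv /= lexx ler01.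
by exists 1; rewrite /g ?scale1r ?subrKC //= in_itv /= lexx ler01.
Qed.

End Regions.

(** * The bijection *)

Lemma label_unique (R : realFieldType) n (e : rel 'I_n) (y : 'I_n -> R) a b :
  chain_label e y a -> chain_label e y b -> a = b.
Proof.
move=> [root_a step_a] [root_b step_b]; apply/funext => i.
elim/ltn_ind: (nat_of_ord i) {-2}i (erefl (nat_of_ord i)) => m IH j Ej.
have [/existsP[k akj]|] := boolP [exists k, arc e y k j]; last first.
  by rewrite negb_exists => /forallP no_arc; rewrite root_a ?root_b.
rewrite -(step_a _ _ akj) -(step_b _ _ akj); apply: (IH k) => //.
by rewrite -Ej (arc_ltn akj).
Qed.

(** A label never exceeds the position, so the [p] leftmost points all have labels below [p]. *)
Lemma label_parking (R : realFieldType) n (e : rel 'I_n) (y : 'I_n -> R) a :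
  injective y -> chain_label e y a -> parking a.
Proof.
move=> y_inj ya p le_pn.
have lt_n (q : 'I_p) : (q < n)%N := leq_trans (ltn_ord q) le_pn.
have [f f_pos] := choice (fun q : 'I_p => pos_surj y_inj (lt_n q)).
have f_inj : injective f.
  by move=> q r eq_f; apply: val_inj; rewrite /= -[LHS]f_pos eq_f f_pos.
rewrite -[X in (X <= _)%N]card_ord -(card_imset _ f_inj) subset_leq_card //.
apply/fintype.subsetP => _ /imsetP[q _ ->]; rewrite inE.
by rewrite (leq_ltn_trans (label_le_pos ya _)) // f_pos.
Qed.

Lemma chain_label_same_side (R : realType) n (e : rel 'I_n) (x x' : 'rV[R^o]_n) a :
  same_side e x x' -> chain_label e (opp_coord x) a -> chain_label e (opp_coord x') a.
Proof.
move=> same.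
have le_same i j : (opp_coord x i <= opp_coord x j) = (opp_coord x' i <= opp_coord x' j).
  by rewrite !leNgt (same j i).1.
have arc_same i j : arc e (opp_coord x) i j = arc e (opp_coord x') i j.
  rewrite /arc (same i j).2; congr (_ && _).
  apply: eq_forallb => k; apply: eq_forallb => l.
  by rewrite (same k l).2 !le_same.
have pos_same i : pos (opp_coord x) i = pos (opp_coord x') i.
  by apply: eq_card => k; rewrite !inE (same k i).1.
move=> [root_i step_i]; split=> [i no_arc|k i].
  by rewrite -pos_same root_i // => k; rewrite arc_same.
by rewrite -arc_same; exact: step_i.
Qed.

Lemma image_card_le (T : choiceType) (U V : Type) (A : set T) (f : T -> U) (g : T -> V) :
  (forall x x', A x -> A x' -> g x = g x' -> f x = f x') ->
  (f @` A) #<= (g @` A).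
Proof.
move=> gf; have [[x0 Ax0]|A0] := pselect (A !=set0); last first.
  have -> : A = set0 by apply/seteqP; split=> x // Ax; case: A0; exists x.
  by rewrite !image_set0.
(* [f] factors through [g] on [A]: any preimage under [g] will do, and [x0] is only a default
   value. *)
pose h v := f (xget x0 [set x | A x /\ g x = v]).
have -> : f @` A = h @` (g @` A); last exact: card_image_le.
have hg x : A x -> h (g x) = f x.
  move=> Ax; rewrite /h; case: xgetP => [z _ [Az eq_g]|/(_ x) []//].
  exact: gf.
apply/seteqP; split=> [_ [x Ax <-]|_ [_ [x Ax <-] <-]].
  by exists (g x); [exact: imageP | exact: hg].
by exists x; rewrite ?hg.
Qed.

Lemma image_card_eq (T : choiceType) (U V : Type) (A : set T) (f : T -> U) (g : T -> V) :
  (forall x x', A x -> A x' -> f x = f x' <-> g x = g x') ->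
  (f @` A) #= (g @` A).
Proof.
move=> fg; rewrite card_eq_le; apply/andP.
by split; apply: image_card_le => x x' Ax Ax' /fg; apply.
Qed.

Theorem theorem1p2 (R : realType) (n : nat) (e : rel 'I_n) :
  (0 < n)%N -> simple_graph e ->
  @S_regions R n e #= @good_cosets n e.
Proof.
move=> n_gt0 _.
have [lab labP] := choice (fun x : 'rV[R^o]_n => chain_label_exists e (opp_coord x)).
pose comp x := connected_component (@S_complement R n e) x.
pose coset x := cosetH (row_of_nat (lab x)).
have -> : @S_regions R n e = comp @` @S_complement R n e.
  by apply/seteqP; split=> C [x Sx xC]; exists x.
(* Regions and good cosets are both images of the complement, so it suffices that the two maps have
   the same fibres. *)
have -> : @good_cosets n e = coset @` @S_complement R n e; last first.
  apply: image_card_eq => x x' Sx Sx'.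
  have [x_inj _] := (S_complementP e x).1 Sx.
  have [x'_inj _] := (S_complementP e x').1 Sx'.
  split=> [eq_comp|eq_coset].
    have : comp x x' by rewrite eq_comp; exact: connected_component_refl.
    move=> /(component_same_side Sx)/chain_label_same_side-/(_ _ (labP x)).
    by move=> /label_unique/(_ (labP x')); rewrite /coset => ->.
  have eq_lab : lab x = lab x'.
    by apply: parking_coset_inj eq_coset => //; exact: label_parking (labP _).
  have labx := labP x; rewrite eq_lab in labx.
  apply: same_side_component => // i j.
  rewrite -!ltn_pos !(label_pos x_inj x'_inj labx (labP x')).
  by rewrite (label_close x_inj x'_inj labx (labP x')).
apply/seteqP; split=> [_ [b -> good_b]|_ [x Sx <-]].
  (* Every good coset is attained: its parking representative is again good, hence is the label of a
     point of the complement. *)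
  have [a [m [park_a a_b]]] := parking_in_coset b n_gt0.
  have a_le i : (a i <= n)%N by rewrite ltnW // parking_lt.
  have good_a : forall i j, next_in_class a i j -> e i j.
    by apply/(good_row_of_nat _ n_gt0 a_le); rewrite a_b; exact: good_rep_shift.
  have [y [y_inj y_ne ya]] := chain_label_surj R park_a good_a.
  pose x : 'rV[R^o]_n := \row_i - y i.
  have xE : opp_coord x = y by apply/funext => i; rewrite /opp_coord mxE opprK.
  exists x; first by apply/S_complementP; rewrite xE.
  have -> : coset x = cosetH (row_of_nat a).
    by rewrite /coset (label_unique (labP x) (b := a)) // xE.
  by apply/esym/cosetHP => //; exists m.
have [x_inj _] := (S_complementP e x).1 Sx.
exists (row_of_nat (lab x)) => //.
apply/(good_row_of_nat _ n_gt0) => [i|]; last exact: label_good (labP x).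
exact: ltnW (label_lt (labP x) i).
Qed.
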